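(* In the setting of the context (soft contracts, optimal shadow prices $\lambda^*$, and real-time allocation by approximate core marginal welfares), let $\bar\epsilon=\min_{0\le i\le I_c}\bar\epsilon_i$ with $\bar\epsilon_i=\mathbb{E}[\boldsymbol\epsilon_i]$, let $X_n=\widehat P_n-\lambda_n^*$ and $$t_n=X_n\gamma_n-\widehat P_n\max\{0,\gamma_n\}.$$ If the optimal expected social welfare $\mathbb{E}[W]^*$ is positive, then the ratio of the achieved expected social welfare $\mathrm{Wf}^{\mathrm{Achi}}$ under the approximate allocation to the optimal one satisfies $$\frac{\mathrm{Wf}^{\mathrm{Achi}}}{\mathbb{E}[W]^*}\ \ge\ \bar\epsilon+\sum_{n=1}^N\frac{(1-\bar\epsilon)\big(\tau_n\mathbb{E}[w_n^c]^*+(1-\tau_n)\mathbb{E}[\widetilde w_n^c]^*\big)+\rho S\,t_n}{\mathbb{E}[W]^*}.$$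
   Context: **Model.** There are finitely many spot market users $\mathcal M=\{1,\dots,M\}$ and contract users $\mathcal N=\{1,\dots,N\}$, and a finite simple conflict graph $G$ on $\mathcal M\sqcup\mathcal N$. There are $S$ units of spectrum, each idle with probability $\rho\in(0,1]$. The valuations of all users for a unit of spectrum form a random vector $\Theta=(v_1,\dots,v_M;u_1,\dots,u_N)$ with nonnegative components of finite mean and joint density $f_\Theta$ ($\Theta$ also denotes its range; $v_m(\theta),u_n(\theta)$ are the components of a realization $\theta$). Contract user $n$ has constants $B_n$, $D_n\ge0$ (demand), $\widehat P_n\ge0$ (unit penalty) and $\tau_n\in[0,1]$. Let $I^c_0=\emptyset$ and let $I^c_1,\dots,I^c_{I_c}$ be the nonempty independent sets of the subgraph of $G$ induced on $\mathcal N$; $l_n^i=1$ if $n\in I^c_i$, else $0$. The side market of $I_i^c$ is the subgraph of $G$ induced on the spot market users not adjacent to any user in $I_i^c$; $z_i(\theta)$ is the maximum weight of an independent set (possibly empty) of this side market, with vertex weights $v_m(\theta)$. **Optimal shadow prices.** Let $H_i(\theta)=-z_0(\theta)+z_i(\theta)+\sum_n l_n^i(\tau_n\widehat P_n+(1-\tau_n)u_n(\theta))$ for $1\le i\le I_c$. $\lambda^*=(\lambda^*_1,\dots,\lambda_N^* )$ is a vector of optimal shadow prices if there are measurable functions $a_i^*,\mu_i^*,\eta^*$ on $\Theta$ such that for all $\theta,i,n$: $a_i^*(\theta)\ge0$, $\mu_i^*(\theta)\ge0$, $\mu_i^*(\theta)a_i^*(\theta)=0$; $\sum_{i=1}^{I_c}a_i^*(\theta)\le1$,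 $\eta^*(\theta)\ge0$, $\eta^*(\theta)(1-\sum_ia_i^*(\theta))=0$; $\mathbb{E}[d_n]:=\sum_il_n^i\rho S\int a_i^*f_\Theta d\theta\le D_n$, $\lambda_n^*\ge0$, $\lambda_n^*(D_n-\mathbb{E}[d_n])=0$; and, with $\dot w_i(\theta)=\rho SH_i(\theta)+\mu_i^*(\theta)-\eta^*(\theta)-\rho S\sum_nl_n^i\lambda_n^*$, $a_i^*(\theta)=0$ if $\dot w_i(\theta)<0$ and $a_i^*(\theta)=1$ if $\dot w_i(\theta)>0$. **Precise and approximate core marginal welfare.** For $1\le i\le I_c$, $w_i(\theta)=\rho S\big(-z_0(\theta)+z_i(\theta)+\sum_nl_n^i(\tau_n\widehat P_n+(1-\tau_n)u_n(\theta)-\lambda_n^* )\big)$. The performance ratios of the approximate maximum weight independent set algorithm used to compute $z_0,\dots,z_{I_c}$ form a random vector $\boldsymbol\epsilon=(\boldsymbol\epsilon_0,\dots,\boldsymbol\epsilon_{I_c})\in[0,1]^{I_c+1}$ with mutually independent components, independent of $\Theta$; for a realization $\epsilon$, $\widetilde w_i(\theta,\epsilon)=\rho S\big(-\epsilon_0z_0(\theta)+\epsilon_iz_i(\theta)+\sum_nl_n^i(\tau_n\widehat P_n+(1-\tau_n)u_n(\theta)-\lambda_n^* )\big)$. *Optimal allocation*: an idle spectrum $\theta$ goes to the contract set $I_i^c$ ($i\ge1$) if $w_i(\theta)>0$ and $w_i(\theta)>\max_{j\ne i,\,j\ge1}w_j(\theta)$ (set of such $\theta$: $\Theta_i$), and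 to index $0$ (spot market only) if $w_i(\theta)<0$ for all $i\ge1$ (set of such $\theta$: $\Theta_0$). It is simultaneously used by a maximum weight independent set of the corresponding side market, producing spot welfare $z_i(\theta)$. *Approximate allocation*: the same rule with $\widetilde w_i(\theta,\epsilon)$ in place of $w_i(\theta)$; if index $j$ is chosen, the spot welfare produced is $\epsilon_jz_j(\theta)$. It is assumed that ties (in either rule) have probability zero, so each rule chooses a unique index almost surely. **Welfare.** For either rule, if $q_n$ is the probability that the chosen set contains contract user $n$, then $\mathbb{E}[d_n]=\rho Sq_n$, $\mathbb{E}[w_n^c]=B_n-\widehat P_n\max\{0,D_n-\mathbb{E}[d_n]\}$, $\mathbb{E}[\widetilde w_n^c]=\rho S\,\mathbb{E}[u_n(\Theta)\mathbf 1\{n\text{ in chosen set}\}]$, and the expected social welfare is $\rho S\cdot\mathbb{E}[\text{spot welfare produced}]+\sum_n(\tau_n\mathbb{E}[w_n^c]+(1-\tau_n)\mathbb{E}[\widetilde w_n^c])$. For the optimal allocation these quantities are denoted with a star, with total $\mathbb{E}[W]^*$; for the approximate allocation the total is $\mathrm{Wf}^{\mathrm{Achi}}$. **Allocation changes.** For $i\neq j$ in $\{0,\dots,I_c\}$ let $\beta_i^j$ be the probability that $\theta\in\Theta_i$ and the approximate rule chooses $j$. For $i\ge1$ put $\Delta_i=\sum_{j\ne i,\,0\le j\le I_c}(\beta_i^j-\beta_j^i)$, and $\gamma_n=\sum_{i=1}^{I_c}l_n^i\Delta_i$ (the decrease in the average probability of allocating a spectrum to contract user $n$). *)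

(* Defs.v *)
From HB Require Import structures.
From mathcomp Require Import all_boot all_order all_algebra.
From mathcomp Require Import all_classical all_reals all_analysis.

Set Implicit Arguments.
Unset Strict Implicit.
Unset Printing Implicit Defensive.

Import Order.TTheory GRing.Theory Num.Theory.
Import numFieldNormedType.Exports.

Local Open Scope classical_set_scope.
Local Open Scope ring_scope.

Section lebesgue_tuple.
Context {R : realType}.

(* [measurableTypeR R], on which [lebesgue_measure] lives, and [R] carry the same
   sigma-algebra under different displays. *)
Definition tcons n (p : measurableTypeR R * n.-tuple R) : n.+1.-tuple R :=
  [tuple of (p.1 : R) :: p.2].

Definition tuncons n (t : n.+1.-tuple R) : measurableTypeR R * n.-tuple R :=
  (thead t, [tuple of behead t]).

Lemma tconsK n : cancel (@tcons n) (@tuncons n).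
Proof. by case=> x t; rewrite /tuncons theadE; congr pair; apply: val_inj. Qed.

Lemma measurable_tcons n : measurable_fun setT (@tcons n).
Proof.
by apply: measurable_cons; [exact: measurable_fst|exact: measurable_snd].
Qed.

Lemma measurable_tuncons n : measurable_fun setT (@tuncons n).
Proof.
apply/measurable_fun_pairP; split; last exact: measurable_behead.
exact: (@measurable_tnth _ _ _ ord0).
Qed.

Section step.
Local Open Scope ereal_scope.
Variables (n : nat) (m : {sigma_finite_measure set (n.-tuple R) -> \bar R}).

Let mu : {measure set (measurableTypeR R * n.-tuple R)%type -> \bar R} :=
  @lebesgue_measure R \x m.

Definition leb_step : set (n.+1.-tuple R) -> \bar R :=
  pushforward mu (@tcons n).

Let mtcons A : measurable A -> measurable (@tcons n @^-1` A).
Proof.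
by move=> mA; rewrite -[X in measurable X]setTI; exact: measurable_tcons.
Qed.

Let leb_step0 : leb_step set0 = 0.
Proof. by rewrite /leb_step/pushforward preimage_set0 measure0. Qed.

Let leb_step_ge0 A : 0 <= leb_step A.
Proof. exact: (measure_ge0 mu). Qed.

Let leb_step_sigma_additive : semi_sigma_additive leb_step.
Proof.
move=> F mF tF mUF; rewrite /leb_step/pushforward preimage_bigcup.
apply: (@measure_semi_sigma_additive _ _ _ mu) => [k||].
- exact: mtcons.
- apply/trivIsetP => /= i j _ _ ij; rewrite -preimage_setI.
  by move/trivIsetP : tF => /(_ _ _ _ _ ij) ->//; rewrite preimage_set0.
- by rewrite -preimage_bigcup; exact: mtcons.
Qed.

HB.instance Definition _ := isMeasure.Build _ _ _ leb_step
  leb_step0 leb_step_ge0 leb_step_sigma_additive.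

Let leb_step_sigma_finite : sigma_finite setT leb_step.
Proof.
have /sigma_finiteP[F [TF ndF Foo]] := sigma_finiteT (@lebesgue_measure R).
have /sigma_finiteP[G [TG ndG Goo]] := sigma_finiteT m.
exists (fun k => @tuncons n @^-1` (F k `*` G k)) => [|k].
  rewrite -preimage_bigcup -[LHS](preimage_setT (@tuncons n)); congr preimage.
  rewrite -setXTT TF TG predeqE => -[x y]; split => [[/= [i _ Fx] [j _ Gy]]|].
    by exists (maxn i j) => //; split;
      [move: x Fx|move: y Gy]; apply/subsetPset;
      [apply/ndF/leq_maxl|apply/ndG/leq_maxr].
  by move=> [i _ []/= ? ?]; split; exists i.
have [mF Fk] := Foo k; have [mG Gk] := Goo k; split.
  by rewrite -[X in measurable X]setTI; apply: measurable_tuncons => //;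
    exact: measurableX.
rewrite /leb_step /pushforward -comp_preimage.
rewrite (_ : _ \o _ = id) ?preimage_id; last first.
  by apply/funext => x /=; rewrite tconsK.
by rewrite /mu/= product_measure1E// lte_mul_pinfty// ge0_fin_numE.
Qed.

HB.instance Definition _ := Measure_isSigmaFinite.Build _ _ _ leb_step
  leb_step_sigma_finite.

End step.

(* Lebesgue measure on R^n: iterated product, transported along [tcons]. *)
Fixpoint lebesgue_tuple n : {sigma_finite_measure set (n.-tuple R) -> \bar R} :=
  if n is n'.+1 then leb_step (lebesgue_tuple n') else \d_ [tuple].

End lebesgue_tuple.

Section independence.
Context {R : realType} {d : measure_display} {Om : measurableType d}.
Variable P : probability Om R.

Definition independent2 {d1 d2} {T1 : measurableType d1}
    {T2 : measurableType d2} (X : Om -> T1) (Y : Om -> T2) : Prop :=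
  forall A B, measurable A -> measurable B ->
    P (X @^-1` A `&` Y @^-1` B) = (P (X @^-1` A) * P (Y @^-1` B))%E.

Definition mutually_independent {d1} {T1 : measurableType d1} {I : finType}
    (X : I -> Om -> T1) : Prop :=
  forall (J : {set I}) (A : I -> set T1), (forall i, measurable (A i)) ->
    P (\bigcap_(i in [set` J]) X i @^-1` A i) =
    (\prod_(i in J) P (X i @^-1` A i))%E.

Definition has_joint_density {n} (X : {RV P >-> n.-tuple R})
    (f : n.-tuple R -> R) : Prop :=
  [/\ measurable_fun setT f, forall t, 0 <= f t &
   forall A, measurable A ->
     distribution P X A = (\int[lebesgue_tuple n]_(t in A) (f t)%:E)%E].

End independence.

Definition independent_set {V : finType} (e : rel V) (A : {set V}) : bool :=
  [forall x in A, forall y in A, ~~ e x y].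

(* [idle] is rho, [nunits] is S, and [benefit], [demand], [penalty] are the
   constants B_n, D_n and \hat P_n of the contracts.
   [cset i] is the i-th contract set: index [ord0] is the empty set and the
   indices [i != ord0] enumerate, without repetition, the nonempty independent
   sets of the conflict graph induced on the contract users. *)
Record market (R : realType) := Market {
  nspot : nat;
  ncontract : nat;
  conflict : rel ('I_nspot + 'I_ncontract);
  conflict_sym : symmetric conflict;
  conflict_irr : irreflexive conflict;
  nunits : nat;
  idle : R;
  idle01 : 0 < idle <= 1;
  benefit : 'I_ncontract -> R;
  demand : 'I_ncontract -> R;
  demand_ge0 : forall n, 0 <= demand n;
  penalty : 'I_ncontract -> R;
  penalty_ge0 : forall n, 0 <= penalty n;
  tau : 'I_ncontract -> R;
  tau01 : forall n, 0 <= tau n <= 1;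
  ncset : nat;
  cset : 'I_ncset.+1 -> {set 'I_ncontract};
  cset_inj : injective cset;
  cset0 : cset ord0 = finset.set0;
  csetP : forall A : {set 'I_ncontract},
    independent_set (relpre inr conflict) A <-> exists i, cset i = A
}.

Section market_defs.
Context {R : realType} (mk : market R).

Local Notation M := (nspot mk).
Local Notation N := (ncontract mk).
Local Notation Ic := (ncset mk).

(* [rho * S] *)
Definition supply : R := idle mk * (nunits mk)%:R.

(* A realization is the tuple (v_1, ..., v_M, u_1, ..., u_N). *)
Definition spot_val (t : (M + N).-tuple R) (m : 'I_M) : R := tnth t (lshift N m).
Definition contract_val (t : (M + N).-tuple R) (n : 'I_N) : R :=
  tnth t (rshift M n).

Definition mem_cset (i : 'I_Ic.+1) (n : 'I_N) : R := (n \in cset i)%:R.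

Definition side_users (i : 'I_Ic.+1) : {set 'I_M} :=
  [set m | [forall n in cset i, ~~ conflict (inl m) (inr n)]].

(* The empty set is always among the candidates, so that the default value 0 of
   the iterated maximum is attained. *)
Definition side_welfare (i : 'I_Ic.+1) (t : (M + N).-tuple R) : R :=
  \big[Num.max/0]_(J : {set 'I_M} |
      (J \subset side_users i) && independent_set (relpre inl (@conflict _ mk)) J)
    \sum_(m in J) spot_val t m.

(* H_i *)
Definition marginal_value (i : 'I_Ic.+1) (t : (M + N).-tuple R) : R :=
  - side_welfare ord0 t + side_welfare i t
  + \sum_n mem_cset i n *
      (tau n * penalty n + (1 - tau n) * contract_val t n).

Definition shadow_demand (Theta : set ((M + N).-tuple R))
    (f : (M + N).-tuple R -> R) (a : 'I_Ic.+1 -> (M + N).-tuple R -> R)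
    (n : 'I_N) : R :=
  \sum_(i | i != ord0) mem_cset i n * supply *
    \int[lebesgue_tuple (M + N)]_(t in Theta) (a i t * f t).

(* \dot w_i *)
Definition shadow_weight (lambda : 'I_N -> R)
    (mu : 'I_Ic.+1 -> (M + N).-tuple R -> R) (eta : (M + N).-tuple R -> R)
    (i : 'I_Ic.+1) (t : (M + N).-tuple R) : R :=
  supply * marginal_value i t + mu i t - eta t
  - supply * \sum_n mem_cset i n * lambda n.

Definition optimal_shadow_prices (Theta : set ((M + N).-tuple R))
    (f : (M + N).-tuple R -> R) (lambda : 'I_N -> R) : Prop :=
  exists (a mu : 'I_Ic.+1 -> (M + N).-tuple R -> R)
         (eta : (M + N).-tuple R -> R),
  [/\ (forall i, i != ord0 ->
         measurable_fun Theta (a i) /\ measurable_fun Theta (mu i)) /\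
      measurable_fun Theta eta,
      forall t i, Theta t -> i != ord0 ->
        [/\ 0 <= a i t, 0 <= mu i t & mu i t * a i t = 0],
      forall t, Theta t ->
        [/\ \sum_(i | i != ord0) a i t <= 1, 0 <= eta t &
            eta t * (1 - \sum_(i | i != ord0) a i t) = 0],
      forall n,
        [/\ shadow_demand Theta f a n <= demand n, 0 <= lambda n &
            lambda n * (demand n - shadow_demand Theta f a n) = 0] &
      forall t i, Theta t -> i != ord0 ->
        (shadow_weight lambda mu eta i t < 0 -> a i t = 0) /\
        (0 < shadow_weight lambda mu eta i t -> a i t = 1)].

Definition core_welfare (lambda : 'I_N -> R) (i : 'I_Ic.+1)
    (t : (M + N).-tuple R) : R :=
  supply * (- side_welfare ord0 t + side_welfare i t
    + \sum_n mem_cset i n *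
        (tau n * penalty n + (1 - tau n) * contract_val t n - lambda n)).

Definition approx_core_welfare (lambda : 'I_N -> R) (i : 'I_Ic.+1)
    (t : (M + N).-tuple R) (e : Ic.+1.-tuple R) : R :=
  supply * (- (tnth e ord0 * side_welfare ord0 t) + tnth e i * side_welfare i t
    + \sum_n mem_cset i n *
        (tau n * penalty n + (1 - tau n) * contract_val t n - lambda n)).

(* Whether index [i] is selected when the (exact or approximate) core marginal
   welfares are [w]; [w ord0] is never inspected. *)
Definition selected (w : 'I_Ic.+1 -> R) (i : 'I_Ic.+1) : bool :=
  if i == ord0 then [forall j, (j != ord0) ==> (w j < 0)]
  else (0 < w i) && [forall j, ((j != i) && (j != ord0)) ==> (w j < w i)].

Section allocation.
Context {d : measure_display} {Om : measurableType d} (P : probability Om R).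
Variables (X : Om -> (M + N).-tuple R) (eps : Om -> Ic.+1.-tuple R).
Variable lambda : 'I_N -> R.

Definition opt_alloc (o : Om) (i : 'I_Ic.+1) : bool :=
  selected (fun j => core_welfare lambda j (X o)) i.

Definition approx_alloc (o : Om) (i : 'I_Ic.+1) : bool :=
  selected (fun j => approx_core_welfare lambda j (X o) (eps o)) i.

Definition opt_spot (o : Om) (i : 'I_Ic.+1) : R := side_welfare i (X o).

Definition approx_spot (o : Om) (i : 'I_Ic.+1) : R :=
  tnth (eps o) i * side_welfare i (X o).

(* Below, [c o i] says that a rule selects index [i] at outcome [o], and [s o i]
   is the spot welfare it then produces. *)
Definition served (c : Om -> 'I_Ic.+1 -> bool) (n : 'I_N) (o : Om) : bool :=
  [exists i, c o i && (n \in cset i)].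

(* E[d_n] *)
Definition expected_alloc (c : Om -> 'I_Ic.+1 -> bool) (n : 'I_N) : R :=
  supply * fine (P [set o | served c n o]).

(* E[w_n^c] *)
Definition contract_welfare (c : Om -> 'I_Ic.+1 -> bool) (n : 'I_N) : R :=
  benefit n - penalty n * Num.max 0 (demand n - expected_alloc c n).

(* E[\tilde w_n^c] *)
Definition user_welfare (c : Om -> 'I_Ic.+1 -> bool) (n : 'I_N) : R :=
  supply * fine 'E_P[fun o => contract_val (X o) n * (served c n o)%:R].

Definition social_welfare (c : Om -> 'I_Ic.+1 -> bool)
    (s : Om -> 'I_Ic.+1 -> R) : R :=
  supply * fine 'E_P[fun o => \sum_(i | c o i) s o i]
  + \sum_n (tau n * contract_welfare c n + (1 - tau n) * user_welfare c n).

Definition beta (i j : 'I_Ic.+1) : R :=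
  fine (P [set o | opt_alloc o i && approx_alloc o j]).

Definition Delta (i : 'I_Ic.+1) : R := \sum_(j | j != i) (beta i j - beta j i).

Definition gamma (n : 'I_N) : R :=
  \sum_(i | i != ord0) mem_cset i n * Delta i.

Definition tterm (n : 'I_N) : R :=
  (penalty n - lambda n) * gamma n - penalty n * Num.max 0 (gamma n).

Definition mean_ratio (i : 'I_Ic.+1) : R := fine 'E_P[fun o => tnth (eps o) i].

Definition min_mean_ratio : R :=
  \big[Num.min/mean_ratio ord0]_(i < Ic.+1) mean_ratio i.

End allocation.

End market_defs.

(* Main.v *)
(** The approximate core marginal welfare of index 0 vanishes, so the approximate
    rule picks, at each outcome, an index of maximal approximate core marginal
    welfare; in particular it does at least as well as the optimal index does for
    the approximate values. Taking expectations bounds the priced value achieved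
    from below by that of the optimal allocation with spot welfare scaled by
    [eps]. As the optimal index depends on [X] only, independence turns this
    spot welfare into at least [ebar] times the optimal one. Finally
    [gamma n] is the loss in the probability of serving user [n], so the shortfall
    penalty grows by at most [supply * penalty n * max 0 (gamma n)]. *)

Require Import Defs.
From mathcomp Require Import all_boot all_order all_algebra.
From mathcomp Require Import all_classical all_reals all_analysis.
From HB Require Import structures.
From mathcomp Require Import measurable_realfun ring lra.

Set Implicit Arguments.
Unset Strict Implicit.
Unset Printing Implicit Defensive.

Import Order.TTheory GRing.Theory Num.Theory.
Import numFieldNormedType.Exports.

Local Open Scope classical_set_scope.
Local Open Scope ring_scope.

(** * Measurability and real-valued integrals of finite sums, maxima and Boolean indicators *)

Section real_integral.
Context {R : realType} {d : measure_display} {T : measurableType d}.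

Lemma measurable_fun_natr_bool (b : T -> bool) :
  measurable_fun setT b -> measurable_fun setT (fun x => (b x)%:R : R).
Proof.
move=> mb; rewrite (_ : (fun _ => _) = fun x => if b x then 1 else 0).
  exact: measurable_fun_ifT.
by apply/funext => x; case: (b x).
Qed.

Lemma measurable_fun_forall (I : finType) (b : I -> T -> bool) :
  (forall i, measurable_fun setT (b i)) ->
  measurable_fun setT (fun x => [forall i, b i x]).
Proof.
move=> mb; rewrite (_ : (fun _ => _) = fun x => \big[andb/true]_(i : I) b i x).
  elim: (index_enum I) => [|i s IHs].
    by under eq_fun do rewrite big_nil; exact: measurable_cst.
  by under eq_fun do rewrite big_cons; exact: measurable_and.
by apply/funext => x; rewrite big_andE.
Qed.

Lemma measurable_fun_bigmaxr (I : finType) (Q : pred I) (h : I -> T -> R) :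
  (forall i, Q i -> measurable_fun setT (h i)) ->
  measurable_fun setT (fun x => \big[Num.max/0]_(i | Q i) h i x).
Proof.
move=> mh; elim: (index_enum I) => [|i s IHs].
  by under eq_fun do rewrite big_nil; exact: measurable_cst.
under eq_fun do rewrite big_cons.
by case: (boolP (Q i)) => Qi //; apply: measurable_maxr => //; exact: mh.
Qed.

Variable mu : {measure set T -> \bar R}.

Lemma Rintegral_sum (I : finType) (g : I -> T -> R) :
  (forall i, mu.-integrable setT (EFin \o g i)) ->
  \int[mu]_x (\sum_i g i x) = \sum_i \int[mu]_x g i x.
Proof.
move=> ig; elim: (index_enum I) => [|i s IHs].
  rewrite big_nil -[RHS](mul0r (fine (mu setT))) -Rintegral_cst//.
  by apply: eq_Rintegral => x _; rewrite big_nil.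
rewrite big_cons -IHs -RintegralD//.
  by apply: eq_Rintegral => x _; rewrite big_cons.
rewrite (_ : EFin \o _ = fun x => \sum_(j <- s) (EFin \o g j) x)%E.
  exact: integrable_sum.
by apply/funext => x; rewrite /= sumEFin.
Qed.

Lemma integrable_sumr (I : finType) (g : I -> T -> R) :
  (forall i, mu.-integrable setT (EFin \o g i)) ->
  mu.-integrable setT (EFin \o (fun x => \sum_i g i x)).
Proof.
move=> ig; rewrite (_ : EFin \o _ = fun x => \sum_i (EFin \o g i) x)%E.
  exact: integrable_sum.
by apply/funext => x; rewrite /= sumEFin.
Qed.

Lemma integrable_natr_boolM (b : T -> bool) (g : T -> R) :
  measurable_fun setT b -> mu.-integrable setT (EFin \o g) ->
  mu.-integrable setT (EFin \o (fun x => (b x)%:R * g x)).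
Proof.
move=> mb ig; apply: le_integrable (ig) => //.
  apply/measurable_EFinP/measurable_funM; first exact: measurable_fun_natr_bool.
  exact/measurable_EFinP/(measurable_int mu).
by move=> x _ /=; rewrite lee_fin normrM; case: (b x); rewrite ?normr1 ?normr0 ?mul1r ?mul0r.
Qed.

Lemma eq_Rintegral_ae (g h : T -> R) :
  measurable_fun setT g -> measurable_fun setT h ->
  {ae mu, forall x, g x = h x} -> \int[mu]_x g x = \int[mu]_x h x.
Proof.
move=> mg mh gh; congr fine; apply: ae_eq_integral => //.
- exact/measurable_EFinP.
- exact/measurable_EFinP.
- by apply: filterS gh => x + _ => ->.
Qed.

Lemma le_Rintegral_ae (g h : T -> R) :
  mu.-integrable setT (EFin \o g) -> mu.-integrable setT (EFin \o h) ->
  {ae mu, forall x, g x <= h x} -> \int[mu]_x g x <= \int[mu]_x h x.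
Proof.
move=> ig ih gh; rewrite -subr_ge0 -RintegralB//.
have mg : measurable_fun setT g by exact/measurable_EFinP/(measurable_int mu).
have mh : measurable_fun setT h by exact/measurable_EFinP/(measurable_int mu).
have mhg : measurable_fun setT (h \- g) by exact: measurable_funB.
(* The difference is nonnegative only almost everywhere; its absolute value agrees with it there and
   is nonnegative at every point. *)
rewrite (@eq_Rintegral_ae _ (fun x => `|h x - g x|)) ?Rintegral_ge0//.
  exact: measurableT_comp.
by apply: filterS gh => x gh; rewrite ger0_norm// subr_ge0.
Qed.

Lemma integrable_scaler (k : R) (g : T -> R) :
  mu.-integrable setT (EFin \o g) ->
  mu.-integrable setT (EFin \o (fun x => k * g x)).
Proof.
by move=> ig; rewrite /comp; under eq_fun do rewrite EFinM; exact: integrableZl.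
Qed.

Lemma integrable_addr (g h : T -> R) :
  mu.-integrable setT (EFin \o g) -> mu.-integrable setT (EFin \o h) ->
  mu.-integrable setT (EFin \o (fun x => g x + h x)).
Proof.
by move=> ig ih; rewrite /comp; under eq_fun do rewrite EFinD; exact: integrableD.
Qed.

(** The factor stays inside the pointwise comparison because core welfares carry the factor
    [supply mk]: nothing is divided by it, so zero supply is not a separate case. *)
Lemma le_scaled_Rintegral_ae (k : R) (g h : T -> R) :
  mu.-integrable setT (EFin \o g) -> mu.-integrable setT (EFin \o h) ->
  {ae mu, forall x, k * g x <= k * h x} ->
  k * \int[mu]_x g x <= k * \int[mu]_x h x.
Proof.
move=> ig ih gh; rewrite -!RintegralZl//.
by apply: le_Rintegral_ae gh; exact: integrable_scaler.
Qed.

End real_integral.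

(** * Factorization of expectations under independence *)

Section independent_product.
Context {R : realType} {d d1 d2 : measure_display} {Om : measurableType d}
  {T1 : measurableType d1} {T2 : measurableType d2}.
Variable P : probability Om R.
Local Open Scope ereal_scope.

(** Independence says that the law of the pair agrees with the product of the two laws on
    rectangles, hence everywhere; Tonelli then splits the integral, nonnegativity replacing
    integrability. *)
Lemma independent2_integralM (X : {RV P >-> T1}) (Y : {RV P >-> T2})
    (g : T1 -> R) (h : T2 -> R) :
  independent2 P X Y ->
  measurable_fun setT g -> measurable_fun setT h ->
  (forall x, 0 <= g x)%R -> (forall y, 0 <= h y)%R ->
  \int[P]_o (g (X o) * h (Y o))%:E =
  \int[P]_o (g (X o))%:E * \int[P]_o (h (Y o))%:E.
Proof.
move=> XY mg mh g0 h0.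
pose Z o := (X o, Y o).
have mZ : measurable_fun setT Z by exact: measurable_fun_pair.
pose gh (p : T1 * T2) := (g p.1 * h p.2)%:E.
have mgh : measurable_fun setT gh.
  apply/measurable_EFinP/measurable_funM.
    exact: measurableT_comp.
  exact: measurableT_comp.
have gh0 p : 0 <= gh p by rewrite lee_fin mulr_ge0.
pose Z' : {mfun Om >-> (T1 * T2)%type} := HB.pack Z (isMeasurableFun.Build _ _ _ _ Z mZ).
rewrite -[LHS]/(\int[P]_o (gh \o Z') o) -(@ge0_integral_distribution _ _ _ _ _ _ Z')//.
pose D1 : probability T1 R := distribution P X.
pose D2 : probability T2 R := distribution P Y.
(* Uniqueness of the product measure reduces equality of the two laws to rectangles, which is
   [XY]. *)
rewrite (@eq_measure_integral _ _ _ setT (D1 \x D2)); last first.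
  move=> A mA _; symmetry; apply: product_measure_unique => //.
rewrite fubini_tonelli1//.
have ge0E (r : R) : (0 <= r)%R -> 0 <= r%:E by rewrite lee_fin.
have -> : \int[D1]_x fubini_F D2 gh x =
    \int[D1]_x ((g x)%:E * \int[D2]_y (h y)%:E).
  apply: eq_integral => x _; rewrite /fubini_F -ge0_integralZl//.
  - exact/measurable_EFinP.
  - by move=> y _; exact: ge0E.
  - exact: ge0E.
rewrite ge0_integralZr//; last 3 first.
- exact/measurable_EFinP.
- by move=> x _; exact: ge0E.
- by apply: integral_ge0 => y _; exact: ge0E.
congr (_ * _).
  rewrite (@ge0_integral_distribution _ _ _ _ _ _ X (EFin \o g))//.
  exact/measurable_EFinP.
rewrite (@ge0_integral_distribution _ _ _ _ _ _ Y (EFin \o h))//.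
exact/measurable_EFinP.
Qed.

End independent_product.

(** * Side markets, core welfares and the selection rule *)

Section market_facts.
Context {R : realType} (mk : market R).

Local Notation M := (nspot mk).
Local Notation N := (ncontract mk).
Local Notation Ic := (ncset mk).

Lemma supply_ge0 : 0 <= supply mk.
Proof. by rewrite mulr_ge0// ltW//; case/andP: (idle01 mk). Qed.

Lemma mem_cset0 n : mem_cset (ord0 : 'I_Ic.+1) n = 0.
Proof. by rewrite /mem_cset cset0 inE. Qed.

Lemma approx_core_welfare0 (lambda : 'I_N -> R) t (e : Ic.+1.-tuple R) :
  approx_core_welfare lambda ord0 t e = 0.
Proof.
rewrite /approx_core_welfare addNr add0r big1 ?mulr0// => n _.
by rewrite mem_cset0 mul0r.
Qed.

(** [selected] compares positive indices with 0 instead of with [w ord0]; once [w ord0 = 0], the two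
    comparisons coincide and the rule is an argmax over all indices. *)
Lemma selected_max (w : 'I_Ic.+1 -> R) i j :
  w ord0 = 0 -> selected w j -> w i <= w j.
Proof.
move=> w0; rewrite /selected; case: (eqVneq j ord0) => [->|j0].
  move=> /forallP/(_ i); case: (eqVneq i ord0) => [->//|_ /=].
  by rewrite w0 => /ltW.
move=> /andP[wj0 /forallP/(_ i)].
case: (eqVneq i j) => [->//|_ /=]; case: (eqVneq i ord0) => [-> _|_ /=].
  by rewrite w0 ltW.
exact: ltW.
Qed.

Lemma side_welfare_ge0 (i : 'I_Ic.+1) t : 0 <= side_welfare i t.
Proof. exact: bigmax_ge_id. Qed.

(** Enlarging the set of users adds only nonnegative weights, first up to all spot users, then up to
    all coordinates. The bound serves as integrable majorant of the side welfares. *)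
Lemma side_welfare_le (i : 'I_Ic.+1) (t : (M + N).-tuple R) :
  (forall k, 0 <= tnth t k) -> side_welfare i t <= \sum_k tnth t k.
Proof.
move=> t0; apply: bigmax_le; first exact: sumr_ge0.
move=> J _; apply: (@le_trans _ _ (\sum_m spot_val t m)).
  rewrite [leRHS](bigID [in J])/= lerDl.
  by apply: sumr_ge0 => m _; exact: t0.
by rewrite big_split_ord/= lerDl; apply: sumr_ge0.
Qed.

Lemma measurable_side_welfare (i : 'I_Ic.+1) :
  measurable_fun setT (@side_welfare _ mk i).
Proof.
apply: measurable_fun_bigmaxr => J _.
rewrite (_ : (fun _ => _) = fun t => \sum_(m <- enum J) spot_val t m).
  by apply: measurable_sum => m; exact: measurable_tnth.
by apply/funext => t; rewrite big_enum.
Qed.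

Lemma measurable_contract_part (lambda : 'I_N -> R) (i : 'I_Ic.+1) :
  measurable_fun setT (fun t : (M + N).-tuple R => \sum_n mem_cset i n *
    (tau n * penalty n + (1 - tau n) * contract_val t n - lambda n)).
Proof.
apply: measurable_sum => n.
apply: measurable_funM; first exact: measurable_cst.
apply: measurable_funB; last exact: measurable_cst.
apply: measurable_funD; first exact: measurable_cst.
apply: measurable_funM; first exact: measurable_cst.
exact: measurable_tnth.
Qed.

Lemma measurable_core_welfare (lambda : 'I_N -> R) (i : 'I_Ic.+1) :
  measurable_fun setT (core_welfare lambda i).
Proof.
apply: measurable_funM; first exact: measurable_cst.
apply: measurable_funD; last exact: measurable_contract_part.
apply: measurable_funD; last exact: measurable_side_welfare.
by apply: measurable_funN; exact: measurable_side_welfare.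
Qed.

Lemma measurable_approx_core_welfare (lambda : 'I_N -> R) (i : 'I_Ic.+1)
    d (T : measurableType d) (X : T -> (M + N).-tuple R) (e : T -> Ic.+1.-tuple R) :
  measurable_fun setT X -> measurable_fun setT e ->
  measurable_fun setT (fun x => approx_core_welfare lambda i (X x) (e x)).
Proof.
move=> mX me.
have mez j : measurable_fun setT
    (fun x => tnth (e x) j * @side_welfare _ mk j (X x)).
  apply: measurable_funM.
    exact: (measurableT_comp (measurable_tnth j) me).
  exact: (measurableT_comp (measurable_side_welfare j) mX).
apply: measurable_funM; first exact: measurable_cst.
apply: measurable_funD.
  by apply: measurable_funD => //; exact: measurable_funN.
exact: (measurableT_comp (measurable_contract_part lambda i) mX).
Qed.

Lemma measurable_selected d (T : measurableType d) (w : 'I_Ic.+1 -> T -> R) i :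
  (forall j, measurable_fun setT (w j)) ->
  measurable_fun setT (fun x => selected (fun j => w j x) i).
Proof.
move=> mw; rewrite /selected; case: (i == ord0).
  apply: measurable_fun_forall => j; case: (j != ord0) => /=.
    by apply: measurable_fun_ltr => //; exact: measurable_cst.
  exact: measurable_cst.
apply: measurable_and; first by apply: measurable_fun_ltr => //; exact: measurable_cst.
apply: measurable_fun_forall => j; case: (_ && _) => /=.
  exact: measurable_fun_ltr.
exact: measurable_cst.
Qed.

(** * Rules choosing a unique index almost surely, and their service probabilities *)

Section allocation_rule.
Context {d : measure_display} {Om : measurableType d} (P : probability Om R).
Variable c : Om -> 'I_Ic.+1 -> bool.

(** With a unique choice, the rule at [o] is the indicator of one index, a form in which sums over
    indices collapse by rewriting. *)
Lemma exists_unique_eq o : (exists! i, c o i) -> {i | c o =1 eq_op^~ i}.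
Proof.
move=> /cid[i [ci uniq_i]]; exists i => j.
by apply/idP/eqP => [cj|->//]; exact/esym/uniq_i.
Qed.

Lemma sum_rule_eq o i (F : 'I_Ic.+1 -> R) :
  c o =1 eq_op^~ i -> \sum_j (c o j)%:R * F j = F i.
Proof.
move=> ci; rewrite (bigD1 i)//= ci eqxx mul1r big1 ?addr0// => j ji.
by rewrite ci (negbTE ji) mul0r.
Qed.

Lemma served_eq o i n : c o =1 eq_op^~ i -> served c n o = (n \in cset i).
Proof.
move=> ci; apply/existsP/idP => [[j]|ni]; last by exists i; rewrite ci eqxx.
by rewrite ci => /andP[/eqP->].
Qed.

Hypothesis mc : forall i, measurable_fun setT (c ^~ i).

Lemma measurable_served n : measurable_fun setT (served c n).
Proof.
(* De Morgan turns the existential into a finite conjunction, whose measurability is known. *)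
rewrite (_ : served c n = fun o => ~~ [forall i, ~~ (c o i && (n \in cset i))]).
  apply: measurable_neg; apply: measurable_fun_forall => i.
  by apply: measurable_neg; apply: measurable_and => //; exact: measurable_cst.
by apply/funext => o; rewrite negb_forall; apply: eq_existsb => i; rewrite negbK.
Qed.

Lemma fine_prob_bool (b : Om -> bool) : measurable_fun setT b ->
  fine (P [set o | b o]) = \int[P]_o (b o)%:R.
Proof.
move=> mb.
have mB : measurable [set o | b o].
  rewrite (_ : [set o | b o] = setT `&` b @^-1` [set true]); first exact: mb.
  by rewrite setTI.
rewrite -(expectation_indic P mB) unlock; congr fine.
by apply: eq_integral => o _; rewrite indicE mem_setE.
Qed.

Lemma integrable_natr_bool (b : Om -> bool) : measurable_fun setT b ->
  P.-integrable setT (EFin \o (fun o => (b o)%:R)).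
Proof.
move=> mb; rewrite (_ : (fun _ => _) = fun o => (b o)%:R * cst 1 o).
  by apply: integrable_natr_boolM => //; exact: finite_measure_integrable_cst.
by apply/funext => o; rewrite mulr1.
Qed.

End allocation_rule.

Section two_rules.
Context {d : measure_display} {Om : measurableType d} (P : probability Om R).
Variables a b : Om -> 'I_Ic.+1 -> bool.
Hypothesis ma : forall i, measurable_fun setT (a ^~ i).
Hypothesis mb : forall i, measurable_fun setT (b ^~ i).
Hypothesis ua : {ae P, forall o, exists! i, a o i}.
Hypothesis ub : {ae P, forall o, exists! i, b o i}.

(** Almost surely exactly one [b o j] holds, so these events split the event [a o i]. This recovers
    a marginal probability from joint ones such as [beta]. *)
Lemma sum_joint_rule (i : 'I_Ic.+1) :
  \sum_j \int[P]_o (a o i && b o j)%:R = \int[P]_o (a o i)%:R.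
Proof.
have mab j : measurable_fun setT (fun o => a o i && b o j) by exact: measurable_and.
rewrite -Rintegral_sum; last by move=> j; exact: integrable_natr_bool.
apply: eq_Rintegral_ae.
- by apply: measurable_sum => j; exact: measurable_fun_natr_bool.
- exact: measurable_fun_natr_bool.
- apply: filterS ub => o /exists_unique_eq[j bj].
  rewrite -[RHS](sum_rule_eq (fun=> (a o i)%:R) bj).
  by apply: eq_bigr => k _; rewrite mulrC -natrM mulnb.
Qed.

(** Almost surely a single set is chosen, so the indicator of service is linear in the indicators of
    the choices. Index 0 drops out because its set is empty. *)
Lemma prob_served n : \int[P]_o (served a n o)%:R =
  \sum_(i | i != ord0) mem_cset i n * \int[P]_o (a o i)%:R.
Proof.
rewrite big_mkcond/=.
transitivity (\sum_i \int[P]_o (mem_cset i n * (a o i)%:R)).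
  rewrite -Rintegral_sum; last first.
    by move=> i; apply: integrable_scaler; exact: integrable_natr_bool.
  apply: eq_Rintegral_ae.
  - by apply: measurable_fun_natr_bool; exact: measurable_served.
  - apply: measurable_sum => i; apply: measurable_funM => //.
    exact: measurable_fun_natr_bool.
  - apply: filterS ua => o /exists_unique_eq[j aj].
    rewrite (served_eq n aj) -[LHS](sum_rule_eq (fun i => mem_cset i n) aj).
    by apply: eq_bigr => k _; rewrite mulrC.
apply: eq_bigr => i _; rewrite RintegralZl//; last exact: integrable_natr_bool.
by case: eqVneq => [->|//]; rewrite mem_cset0 mul0r.
Qed.

End two_rules.

End market_facts.

(** * Scalar inequalities behind the ratio bound *)

(** For one contract user, [a] marks the optimal and [b] the approximate rule; [q] is the service
    probability, [s * u] the user welfare, [l] the price. The shortfall is a 1-Lipschitz function of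
    the expected allocation, which limits its growth to [s * Num.max 0 (qa - qb)]. *)
Lemma penalty_shortfall_le (R : realType) (B p D s t l qa qb ua ub : R) :
  0 <= s -> 0 <= p -> 0 <= t <= 1 ->
  t * (B - p * Num.max 0 (D - s * qa)) + (1 - t) * (s * ua)
    + s * ((p - l) * (qa - qb) - p * Num.max 0 (qa - qb))
    + s * ((1 - t) * ub + (t * p - l) * qb)
  <= t * (B - p * Num.max 0 (D - s * qb)) + (1 - t) * (s * ub)
    + s * ((1 - t) * ua + (t * p - l) * qa).
Proof.
move=> s0 p0 /andP[t0 t1].
set ma := Num.max 0 (D - s * qa); set mb := Num.max 0 (D - s * qb).
set g := Num.max 0 (qa - qb).
have g_ge : 0 <= g - (qa - qb) by rewrite subr_ge0 le_max lexx orbT.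
have mab : 0 <= ma + s * g - mb.
  have ma0 : 0 <= ma by rewrite le_max lexx.
  have sg0 : 0 <= s * g by rewrite mulr_ge0// le_max lexx.
  have maD : D - s * qa <= ma by rewrite le_max lexx orbT.
  (* Adding [s * (qa - qb) <= s * g] to [maD] bounds [D - s * qb] by [ma + s * g]. *)
  have := mulr_ge0 s0 g_ge; rewrite subr_ge0 ge_max => sg.
  by apply/andP; split; lra.
rewrite -subr_ge0.
(* The benefit, the price and the user values cancel; what remains weights two nonnegative slacks by
   [1 - t] and [t]. *)
rewrite (_ : _ - _ = (1 - t) * (s * p) * (g - (qa - qb))
                     + t * p * (ma + s * g - mb)); last by ring.
by rewrite addr_ge0// !mulr_ge0// subr_ge0.
Qed.

(** Primes mark the approximate rule: [z] is spot welfare, [w] the contract part, [v] the priced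
    contract terms, and [y] the approximate spot welfare at the optimal choice. Adding the three
    inequalities cancels [y], [v] and [v']. *)
Lemma welfare_ratio_ge (R : realFieldType) (I : finType)
    (s e W W' z z' y : R) (w w' t v v' : I -> R) :
  0 < W -> W = s * z + \sum_i w i -> W' = s * z' + \sum_i w' i ->
  s * (e * z) <= s * y -> s * (y + \sum_i v i) <= s * (z' + \sum_i v' i) ->
  (forall i, w i + s * t i + s * v' i <= w' i + s * v i) ->
  e + \sum_i ((1 - e) * w i + s * t i) / W <= W' / W.
Proof.
move=> W0 WE W'E zy yz wtv.
have {wtv} : \sum_i (w i + s * t i + s * v' i) <= \sum_i (w' i + s * v i).
  exact: ler_sum.
(* Clearing [W] leaves [e * W] on the left; its contract part completes [(1 - e) * w i] to [w i]. *)
rewrite -mulr_suml ler_pdivlMr// mulrDl divfK ?gt_eqF// WE W'E.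
rewrite !big_split/= -!mulr_sumr => wtv; lra.
Qed.

(** * Comparison of the optimal and approximate rules in expectation *)

Section approximate_allocation.
Context {R : realType} (mk : market R).

Local Notation M := (nspot mk).
Local Notation N := (ncontract mk).
Local Notation Ic := (ncset mk).

Context {d : measure_display} {Om : measurableType d} (P : probability Om R).
Variables (X : {RV P >-> (M + N).-tuple R}) (eps : {RV P >-> Ic.+1.-tuple R}).
Variable lambda : 'I_N -> R.

Local Notation copt := (opt_alloc X lambda).
Local Notation capp := (approx_alloc X eps lambda).

Lemma measurable_opt_alloc i : measurable_fun setT (copt ^~ i).
Proof.
apply: measurable_selected => j.
by apply: (measurableT_comp (measurable_core_welfare lambda j)).
Qed.

Lemma measurable_approx_alloc i : measurable_fun setT (capp ^~ i).
Proof.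
by apply: measurable_selected => j; exact: measurable_approx_core_welfare.
Qed.

Hypothesis X_ge0 : forall o k, 0 <= tnth (X o) k.
Hypothesis X_mean : forall k, P.-integrable setT (fun o => (tnth (X o) k)%:E).
Hypothesis eps01 : forall o i, 0 <= tnth (eps o) i <= 1.

Lemma integrable_side_welfare i :
  P.-integrable setT (EFin \o (fun o => side_welfare i (X o))).
Proof.
apply: (@le_integrable _ _ _ _ _ _ _ (EFin \o (fun o => \sum_k tnth (X o) k))) => //.
- apply/measurable_EFinP.
  by apply: (measurableT_comp (measurable_side_welfare i)).
- move=> o _; rewrite lee_fin !ger0_norm ?side_welfare_ge0 ?sumr_ge0//.
  exact: side_welfare_le.
- exact: integrable_sumr.
Qed.

Lemma measurable_eps i : measurable_fun setT (fun o => tnth (eps o) i).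
Proof. by apply: (measurableT_comp (measurable_tnth i)). Qed.

Lemma integrable_approx_spot i :
  P.-integrable setT (EFin \o (fun o => approx_spot X eps o i)).
Proof.
apply: le_integrable (integrable_side_welfare i) => //.
  apply/measurable_EFinP/measurable_funM; first exact: measurable_eps.
  by apply: (measurableT_comp (measurable_side_welfare i)).
move=> o _; rewrite lee_fin /approx_spot normrM ler_piMl//.
by case/andP: (eps01 o i) => e0 e1; rewrite ger0_norm.
Qed.

Section rule_expectations.
Variable c : Om -> 'I_Ic.+1 -> bool.
Hypothesis mc : forall i, measurable_fun setT (c ^~ i).

(* Net welfare created at [o] when every unit given to contract user [n] is
   charged [lambda n]. For the approximate spot welfare, scaled by [supply mk],
   it is the approximate core marginal welfare of the chosen index plus a term
   independent of the rule, so the approximate rule maximizes it. *)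
Definition priced_value (s : Om -> 'I_Ic.+1 -> R) (o : Om) : R :=
  \sum_i (c o i)%:R * s o i +
  \sum_n ((1 - tau n) * ((served c n o)%:R * contract_val (X o) n)
          + (tau n * penalty n - lambda n) * (served c n o)%:R).

Let integrable_served_val n :
  P.-integrable setT (EFin \o (fun o => (served c n o)%:R * contract_val (X o) n)).
Proof. by apply: integrable_natr_boolM; [exact: measurable_served|exact: X_mean]. Qed.

Let integrable_served n :
  P.-integrable setT (EFin \o (fun o => (served c n o)%:R)).
Proof. by apply: integrable_natr_bool; exact: measurable_served. Qed.

Variable s : Om -> 'I_Ic.+1 -> R.
Hypothesis int_s : forall i, P.-integrable setT (EFin \o (s ^~ i)).

Lemma integrable_priced_value : P.-integrable setT (EFin \o priced_value s).
Proof.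
apply: integrable_addr; apply: integrable_sumr => k.
  exact: integrable_natr_boolM.
by apply: integrable_addr; exact: integrable_scaler.
Qed.

Definition priced_contract (n : 'I_N) : R :=
  (1 - tau n) * \int[P]_o ((served c n o)%:R * contract_val (X o) n)
  + (tau n * penalty n - lambda n) * \int[P]_o (served c n o)%:R.

Lemma Rintegral_priced_value : \int[P]_o priced_value s o =
  \int[P]_o (\sum_i (c o i)%:R * s o i) + \sum_n priced_contract n.
Proof.
rewrite RintegralD//; last 2 first.
- by apply: integrable_sumr => k; exact: integrable_natr_boolM.
- by apply: integrable_sumr => k; apply: integrable_addr; exact: integrable_scaler.
congr (_ + _); rewrite Rintegral_sum; last first.
  by move=> k; apply: integrable_addr; exact: integrable_scaler.
by apply: eq_bigr => n _; rewrite RintegralD ?RintegralZl//; exact: integrable_scaler.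
Qed.

Lemma social_welfareE : social_welfare P X c s =
  supply mk * \int[P]_o (\sum_i (c o i)%:R * s o i) +
  \sum_n (tau n * contract_welfare P c n + (1 - tau n) * user_welfare P X c n).
Proof.
rewrite /social_welfare unlock; congr (_ * _ + _).
congr fine; apply: eq_integral => o _; congr EFin; rewrite big_mkcond.
by apply: eq_bigr => i _; case: (c o i); rewrite ?mul1r ?mul0r.
Qed.

Lemma expected_allocE n :
  expected_alloc P c n = supply mk * \int[P]_o (served c n o)%:R.
Proof. by rewrite /expected_alloc fine_prob_bool//; exact: measurable_served. Qed.

Lemma user_welfareE n : user_welfare P X c n =
  supply mk * \int[P]_o ((served c n o)%:R * contract_val (X o) n).
Proof.
rewrite /user_welfare unlock; congr (_ * fine _).
by apply: eq_integral => o _; rewrite mulrC.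
Qed.

End rule_expectations.

Hypothesis X_eps_indep : independent2 P X eps.

Lemma opt_spot_approx_ge :
  min_mean_ratio P eps * \int[P]_o (\sum_i (copt o i)%:R * side_welfare i (X o))
  <= \int[P]_o (\sum_i (copt o i)%:R * approx_spot X eps o i).
Proof.
have mcopt := measurable_opt_alloc.
have iz i := integrable_natr_boolM (mcopt i) (integrable_side_welfare i).
have iez i := integrable_natr_boolM (mcopt i) (integrable_approx_spot i).
rewrite (Rintegral_sum iz) (Rintegral_sum iez).
rewrite mulr_sumr; apply: ler_sum => i _.
(* The optimal choice and its side welfare form one nonnegative function of [X], to be separated
   from the ratio [tnth (eps o) i]. *)
pose g t := (selected (fun j => core_welfare lambda j t) i)%:R * side_welfare i t.
have g0 t : 0 <= g t by rewrite mulr_ge0// side_welfare_ge0.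
have mg : measurable_fun setT g.
  apply: measurable_funM; last exact: measurable_side_welfare.
  apply: measurable_fun_natr_bool; apply: measurable_selected => j.
  exact: measurable_core_welfare.
have -> : \int[P]_o ((copt o i)%:R * approx_spot X eps o i) =
    \int[P]_o (g (X o)) * mean_ratio P eps i.
  (* [tnth e i] is nonnegative only on the range of [eps]. *)
  pose h (e : Ic.+1.-tuple R) := `|tnth e i|.
  have hE o : tnth (eps o) i = h (eps o).
    by rewrite /h ger0_norm//; case/andP: (eps01 o i).
  have mh : measurable_fun setT h.
    by apply: measurableT_comp => //; exact: measurable_tnth.
  have h0 e : 0 <= h e by exact: normr_ge0.
  rewrite /Rintegral; under eq_integral do rewrite /approx_spot mulrCA hE mulrC.
  rewrite (independent2_integralM X_eps_indep mg mh g0 h0) fineM.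
  - congr (_ * _); rewrite /mean_ratio unlock; congr fine.
    by apply: eq_integral => o _; rewrite hE.
  - by apply: integrable_fin_num => //; exact: (iz i).
  - apply: integrable_fin_num => //.
    apply: (@le_integrable _ _ _ _ _ _ _ (EFin \o cst 1)) => //.
    + by apply/measurable_EFinP; apply: (measurableT_comp mh).
    + move=> o _ /=; rewrite lee_fin /h normr_id normr1 -/(h _) -hE.
      by case/andP: (eps01 o i).
    + exact: finite_measure_integrable_cst.
(* Replacing the mean ratio of index [i] by the minimum is monotone because the integral of [g] is
   nonnegative. *)
rewrite mulrC ler_wpM2l//; last exact: bigmin_le.
by apply: Rintegral_ge0 => o _; exact: g0.
Qed.

Hypothesis opt_no_tie : {ae P, forall o, exists! i, copt o i}.
Hypothesis approx_no_tie : {ae P, forall o, exists! i, capp o i}.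

(** Summing [beta i j] over all [j] gives the probability that the optimal rule picks [i], and
    summing [beta j i] that of the approximate rule; [Delta i] is the difference of these
    marginals. *)
Lemma gammaE n : gamma P X eps lambda n =
  \int[P]_o (served copt n o)%:R - \int[P]_o (served capp n o)%:R.
Proof.
have ma := measurable_opt_alloc; have mb := measurable_approx_alloc.
rewrite !prob_served// -sumrB; apply: eq_bigr => i _; rewrite -mulrBr; congr (_ * _).
rewrite -(sum_joint_rule ma mb approx_no_tie) -(sum_joint_rule mb ma opt_no_tie).
rewrite -sumrB /Delta big_mkcond/=; apply: eq_bigr => j _.
have betaE k l : beta P X eps lambda k l = \int[P]_o (copt o k && capp o l)%:R.
  by rewrite /beta fine_prob_bool//; exact: measurable_and.
rewrite !betaE; under [in X in _ = _ - X]eq_Rintegral do rewrite andbC.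
(* The diagonal term, absent from [Delta], is zero. *)
by case: eqVneq => [->|//]; rewrite subrr.
Qed.

(** The priced terms sit crosswise so that they cancel against those in the comparison of total
    priced values; only true welfares and [tterm] then survive. *)
Lemma contract_term_le n :
  tau n * contract_welfare P copt n + (1 - tau n) * user_welfare P X copt n
    + supply mk * tterm P X eps lambda n + supply mk * priced_contract capp n
  <= tau n * contract_welfare P capp n + (1 - tau n) * user_welfare P X capp n
    + supply mk * priced_contract copt n.
Proof.
have ma := measurable_opt_alloc; have mb := measurable_approx_alloc.
rewrite /contract_welfare (expected_allocE ma) (expected_allocE mb).
rewrite !user_welfareE /tterm gammaE.
by apply: penalty_shortfall_le; [exact: supply_ge0|exact: penalty_ge0|exact: tau01].
Qed.

Lemma approx_priced_value_ge :
  supply mk * \int[P]_o priced_value copt (approx_spot X eps) o <=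
  supply mk * \int[P]_o priced_value capp (approx_spot X eps) o.
Proof.
have iopt := integrable_priced_value measurable_opt_alloc integrable_approx_spot.
have iapp := integrable_priced_value measurable_approx_alloc integrable_approx_spot.
apply: le_scaled_Rintegral_ae => //.
apply: filterS2 opt_no_tie approx_no_tie => o.
move=> /exists_unique_eq[i ai] /exists_unique_eq[j bj].
(* The summand common to both rules is the approximate spot welfare of index 0, which every core
   marginal welfare subtracts. *)
have pricedE (c : Om -> 'I_Ic.+1 -> bool) k : c o =1 eq_op^~ k ->
    supply mk * priced_value c (approx_spot X eps) o =
    approx_core_welfare lambda k (X o) (eps o)
    + supply mk * (tnth (eps o) ord0 * @side_welfare _ mk ord0 (X o)).
  move=> ck; rewrite /priced_value /approx_core_welfare (sum_rule_eq _ ck).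
  rewrite -mulrDr; congr (_ * _); rewrite /approx_spot.
  rewrite (eq_bigr (fun n => mem_cset k n *
      (tau n * penalty n + (1 - tau n) * contract_val (X o) n - lambda n))).
    by ring.
  by move=> n _; rewrite (served_eq n ck) /mem_cset; ring.
rewrite (pricedE _ _ ai) (pricedE _ _ bj) lerD2r.
apply: (selected_max (w := fun k => approx_core_welfare lambda k (X o) (eps o))).
  exact: approx_core_welfare0.
by rewrite -/(approx_alloc X eps lambda o j) bj eqxx.
Qed.

End approximate_allocation.

(** * Assembly of the spot, allocation and contract inequalities *)

Theorem mainTheorem2 (R : realType) (mk : market R)
  (d : measure_display) (Om : measurableType d) (P : probability Om R)
  (Theta : set ((nspot mk + ncontract mk).-tuple R))
  (X : {RV P >-> (nspot mk + ncontract mk).-tuple R})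
  (f : (nspot mk + ncontract mk).-tuple R -> R)
  (eps : {RV P >-> (ncset mk).+1.-tuple R})
  (lambda : 'I_(ncontract mk) -> R)
  (Theta_measurable : measurable Theta)
  (X_range : forall o, Theta (X o))
  (Theta_ge0 : forall t k, Theta t -> 0 <= tnth t k)
  (X_mean : forall k, P.-integrable setT (fun o => (tnth (X o) k)%:E))
  (X_density : has_joint_density X f)
  (eps01 : forall o i, 0 <= tnth (eps o) i <= 1)
  (eps_indep : mutually_independent P (fun i o => tnth (eps o) i))
  (X_eps_indep : independent2 P X eps)
  (lambda_opt : optimal_shadow_prices Theta f lambda)
  (opt_no_tie : {ae P, forall o, exists! i, opt_alloc X lambda o i})
  (approx_no_tie : {ae P, forall o, exists! i, approx_alloc X eps lambda o i})
  (Wopt_gt0 :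
    0 < social_welfare P X (opt_alloc X lambda) (opt_spot X)) :
  let copt := opt_alloc X lambda in
  let Wopt := social_welfare P X copt (opt_spot X) in
  let Wachi :=
    social_welfare P X (approx_alloc X eps lambda) (approx_spot X eps) in
  let ebar := min_mean_ratio P eps in
  Wachi / Wopt >=
    ebar + \sum_(n < ncontract mk)
      ((1 - ebar) * (tau n * contract_welfare P copt n
                     + (1 - tau n) * user_welfare P X copt n)
       + supply mk * tterm P X eps lambda n) / Wopt.
Proof.
cbv zeta.
have X_ge0 o k : 0 <= tnth (X o) k by apply: Theta_ge0; exact: X_range.
have ispot := integrable_approx_spot X_ge0 X_mean eps01.
have spot_ge := ler_wpM2l (supply_ge0 mk)
  (opt_spot_approx_ge lambda X_ge0 X_mean eps01 X_eps_indep).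
have := approx_priced_value_ge X_ge0 X_mean eps01 opt_no_tie approx_no_tie.
rewrite (Rintegral_priced_value lambda X_mean (measurable_opt_alloc X lambda) ispot).
rewrite (Rintegral_priced_value lambda X_mean (measurable_approx_alloc X eps lambda) ispot).
move=> alloc_ge.
apply: (welfare_ratio_ge Wopt_gt0 (social_welfareE _ _ _) (social_welfareE _ _ _)
  spot_ge alloc_ge) => n.
exact: contract_term_le.
Qed.
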